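(* Let $\mathcal{A}$ be a finite group and $m$ a positive integer. Then $$|\mathrm{Aut}(\mathcal{A})|\,\mathcal{E}^w(\mathcal{A},m)=\sum_{k=0}^{\lfloor m/2\rfloor}\sum_{\alpha\in\mathrm{Aut}(\mathcal{A})}\sum_{\substack{\mathcal{S}\le\mathcal{A}\\ \alpha(\mathcal{S})=\mathcal{S}}}\mu_\alpha(\mathcal{S})\left(\sum_{j_1+2j_2+\cdots+kj_k=k}\frac{\prod_{r=1}^{k}\prod_{t=0}^{j_r-1}\left(\frac{|\tilde F_{(\alpha,r)}(\mathcal{S})|+|\tilde I_{(\alpha,r)}(\mathcal{S})|}{2}-rt\right)}{j_1!\,2^{j_2}j_2!\cdots k^{j_k}j_k!}\right)\left(\sum_{j_1+2j_2+\cdots+(m-2k)j_{m-2k}=m-2k}\frac{\prod_{l=1}^{m-2k}\prod_{t=0}^{j_l-1}\left(|\tilde F^o_{(\alpha,l)}(\mathcal{S})|-lt\right)}{j_1!\,2^{j_2}j_2!\cdots(m-2k)^{j_{m-2k}}j_{m-2k}!}\right),$$ and the same identity holds with $|\mathrm{Aut}(\mathcal{A})|\,\mathcal{E}^w(\mathcal{A},m)$ replaced by $|\mathrm{Inn}(\mathcal{A})|\,\mathcal{E}(\mathcal{A},m)$ and the sum over $\alpha\in\mathrm{Aut}(\mathcal{A})$ replaced by the sum over $\alpha\in\mathrm{Inn}(\mathcal{A})$.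
   Context: $\mathcal{A}$ is a finite group with identity $e$. For $\Omega\subseteq\mathcal{A}$ generating $\mathcal{A}$ with $\Omega=\Omega^{-1}$, $e\notin\Omega$, the Cayley graph $C(\mathcal{A},\Omega)$ has vertex set $\mathcal{A}$ and edges $\{g,h\}$ with $g^{-1}h\in\Omega$, and degree $|\Omega|$; $\mathcal{A}$ acts on it by left multiplication. A graph isomorphism $f:C(\mathcal{A},\Omega)\to C(\mathcal{A},\Omega')$ is a weak equivalence if there is $\alpha\in\mathrm{Aut}(\mathcal{A})$ with $f(gu)=\alpha(g)f(u)$ for all $g,u\in\mathcal{A}$, and an equivalence if this holds with $\alpha=\mathrm{id}$. $\mathcal{E}^w(\mathcal{A},m)$ (resp. $\mathcal{E}(\mathcal{A},m)$) is the number of weak equivalence classes (resp. equivalence classes) of Cayley graphs $C(\mathcal{A},\Omega)$ of degree $m$. $\mathrm{Inn}(\mathcal{A})$ is the group of inner automorphisms. For $\alpha\in\mathrm{Aut}(\mathcal{A})$, a subgroup $\mathcal{S}$ with $\alpha(\mathcal{S})=\mathcal{S}$ and a positive integer $n$: $\tilde F_{(\alpha,n)}(\mathcal{S})=\{g\in\mathcal{S}: g\neq g^{-1},\ \alpha^n(g)=g,\ \alpha^l(g)\neq g,\ \alpha^l(g)\neq g^{-1}\ (1\le l<n)\}$; $\tilde I_{(\alpha,n)}(\mathcal{S})=\{g\in\mathcal{S}: g\neq g^{-1},\ \alpha^n(g)=g^{-1},\ \alpha^l(g)\neq g,\ \alpha^l(g)\neq g^{-1}\ (1\le l<n)\}$;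 $\tilde F^o_{(\alpha,n)}(\mathcal{S})=\{g\in\mathcal{S}: g^{-1}=g\neq e,\ \alpha^n(g)=g,\ \alpha^l(g)\neq g\ (1\le l<n)\}$. $\mu_\alpha$ is the Möbius function on the poset of $\alpha$-invariant subgroups of $\mathcal{A}$, defined recursively by $\sum_{\mathcal{S}'\ge\mathcal{S},\,\alpha(\mathcal{S}')=\mathcal{S}'}\mu_\alpha(\mathcal{S}')=1$ if $\mathcal{S}=\mathcal{A}$ and $=0$ if $\mathcal{S}<\mathcal{A}$ (for $\alpha$-invariant $\mathcal{S}$). The inner sums run over tuples of nonnegative integers $(j_1,\dots)$; for $k=0$ (resp. $m-2k=0$) the corresponding bracket equals $1$, and empty products equal $1$. *)

(* Defs.v *)
From mathcomp Require Import all_boot all_order all_algebra all_fingroup.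

Set Implicit Arguments.
Unset Strict Implicit.
Unset Printing Implicit Defensive.

Import GroupScope GRing.Theory.

(* The finite group A is the whole group [set: gT]. *)

Section Cayley.

Variable gT : finGroupType.
Implicit Types (Omega : {set gT}) (f alpha : {perm gT}) (S : {group gT}).

Definition Inn := conj_aut [set: gT] @* [set: gT].

Definition cayley_set Omega : bool :=
  [&& <<Omega>> == [set: gT], Omega^-1 == Omega & 1 \notin Omega].

Definition cayley_adj Omega : rel gT := [rel g h | g^-1 * h \in Omega].

Definition graph_iso (e e' : rel gT) f : bool :=
  [forall g, forall h, e' (f g) (f h) == e g h].

Definition twisted_by alpha f : bool :=
  [forall g, forall u, f (g * u) == alpha g * f u].

Definition cayley_weak_equiv : rel {set gT} := [rel Omega Omega' |
  [exists f : {perm gT}, graph_iso (cayley_adj Omega) (cayley_adj Omega') f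
    && [exists alpha in Aut [set: gT], twisted_by alpha f]]].

Definition cayley_equiv : rel {set gT} := [rel Omega Omega' |
  [exists f : {perm gT}, graph_iso (cayley_adj Omega) (cayley_adj Omega') f
    && twisted_by 1 f]].

(* A Cayley graph determines its connection set (the neighbours of 1), so
   Cayley graphs of degree m are counted through their connection sets. *)
Definition cayley_sets (m : nat) : {set {set gT}} :=
  [set Omega | cayley_set Omega & #|Omega| == m].

Definition num_weak_classes (m : nat) : nat :=
  #|equivalence_partition cayley_weak_equiv (cayley_sets m)|.

Definition num_classes (m : nat) : nat :=
  #|equivalence_partition cayley_equiv (cayley_sets m)|.

Definition Ftilde alpha (n : nat) S : {set gT} :=
  [set g in S | [&& g != g^-1, (alpha ^+ n) g == g &
     [forall l : 'I_n, (0 < l) ==>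
        ((alpha ^+ l) g != g) && ((alpha ^+ l) g != g^-1)]]].

Definition Itilde alpha (n : nat) S : {set gT} :=
  [set g in S | [&& g != g^-1, (alpha ^+ n) g == g^-1 &
     [forall l : 'I_n, (0 < l) ==>
        ((alpha ^+ l) g != g) && ((alpha ^+ l) g != g^-1)]]].

Definition Fotilde alpha (n : nat) S : {set gT} :=
  [set g in S | [&& g^-1 == g, g != 1, (alpha ^+ n) g == g &
     [forall l : 'I_n, (0 < l) ==> ((alpha ^+ l) g != g)]]].

Definition aut_invariant alpha S : bool := alpha @: S == S.

(* The recursion goes up the subgroup lattice; d bounds its remaining depth,
   and d = #|gT| is always enough (see moebiusP). *)
Fixpoint moebius_rec alpha (d : nat) S : int :=
  ((S == [set: gT] :> {set gT})%:R -
   if d is d'.+1 then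
     \sum_(S' : {group gT} | (S \proper S') && aut_invariant alpha S')
        moebius_rec alpha d' S'
   else 0)%R.

Definition moebius alpha S : int := moebius_rec alpha #|gT| S.

Lemma moebiusP alpha S : aut_invariant alpha S ->
  (\sum_(S' : {group gT} | (S \subset S') && aut_invariant alpha S')
     moebius alpha S' = (S == [set: gT] :> {set gT})%:R)%R.
Proof.
have stab d1 d2 (H : {group gT}) : #|gT| - #|H| <= d1 -> #|gT| - #|H| <= d2 ->
    moebius_rec alpha d1 H = moebius_rec alpha d2 H.
  elim: d1 d2 H => [|d1 IH] [|d2] H //= h1 h2.
  - rewrite big1 // => K /andP[/proper_card ltHK _].
    by have := leq_trans ltHK (max_card _); rewrite ltnNge -subn_eq0 -leqn0 h1.
  - rewrite big1 // => K /andP[/proper_card ltHK _].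
    by have := leq_trans ltHK (max_card _); rewrite ltnNge -subn_eq0 -leqn0 h2.
  congr (_ - _)%R; apply: eq_bigr => K /andP[/proper_card ltHK _].
  have lt : #|gT| - #|K| < #|gT| - #|H|.
    by rewrite ltn_sub2l // (leq_trans ltHK (max_card _)).
  by apply: IH; rewrite -ltnS; apply: leq_trans lt _.
move=> invS; rewrite (bigD1 S) /= ?subxx //.
have -> : moebius alpha S = ((S == [set: gT] :> {set gT})%:R -
    \sum_(S' : {group gT} | (S \proper S') && aut_invariant alpha S')
        moebius alpha S')%R.
  rewrite {1}/moebius (stab _ #|gT|.+1) ?leq_subr //.
  exact: leq_trans (leq_subr _ _) (leqnSn _).
rewrite -[RHS]addr0 -addrA; congr (_ + _)%R.
rewrite (eq_bigl (fun S' : {group gT} => (S \proper S') && aut_invariant alpha S')).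
  by rewrite addNr.
move=> K; rewrite properEneq -val_eqE /= eq_sym.
by case: (_ == _); case: (_ \subset _); rewrite /= ?andbT ?andbF.
Qed.

Lemma cayley_equiv_equivalence (m : nat) :
  {in cayley_sets m & &, equivalence_rel cayley_equiv}.
Proof.
have refl X : cayley_equiv X X.
  apply/existsP; exists 1; apply/andP; split; apply/forallP=> g;
  by apply/forallP=> h; rewrite !perm1.
have sym X Y : cayley_equiv X Y -> cayley_equiv Y X.
  case/existsP=> f /andP[/forallP If /forallP Tf]; apply/existsP; exists f^-1.
  apply/andP; split; apply/forallP=> g; apply/forallP=> h.
    by have /forallP/(_ (f^-1 h)) := If (f^-1 g); rewrite !permKV eq_sym.
  rewrite perm1; apply/eqP/(@perm_inj _ f); rewrite permKV.
  by have /forallP/(_ (f^-1 h))/eqP-> := Tf g; rewrite permKV perm1.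
have trans X Y Z : cayley_equiv X Y -> cayley_equiv Y Z -> cayley_equiv X Z.
  case/existsP=> f /andP[/forallP If /forallP Tf].
  case/existsP=> k /andP[/forallP Ik /forallP Tk].
  apply/existsP; exists (f * k); apply/andP; split;
    apply/forallP=> g; apply/forallP=> h; rewrite !permM.
    have /forallP/(_ (f h))/eqP-> := Ik (f g).
    by have /forallP/(_ h) := If g.
  have /forallP/(_ h)/eqP-> := Tf g; rewrite !perm1.
  by have /forallP/(_ (f h))/eqP-> := Tk g; rewrite perm1.
move=> X Y Z _ _ _; split=> // eXY; apply/idP/idP; last exact: trans.
by apply: trans; apply: sym.
Qed.

Lemma cayley_weak_equiv_equivalence (m : nat) :
  {in cayley_sets m & &, equivalence_rel cayley_weak_equiv}.
Proof.
have refl X : cayley_weak_equiv X X.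
  apply/existsP; exists 1; apply/andP; split; last first.
    apply/existsP; exists 1; rewrite group1 /=.
    by apply/forallP=> g; apply/forallP=> h; rewrite !perm1.
  by apply/forallP=> g; apply/forallP=> h; rewrite !perm1.
have sym X Y : cayley_weak_equiv X Y -> cayley_weak_equiv Y X.
  case/existsP=> f /andP[/forallP If /existsP[a /andP[Aa /forallP Tf]]].
  apply/existsP; exists f^-1; apply/andP; split.
    apply/forallP=> g; apply/forallP=> h.
    by have /forallP/(_ (f^-1 h)) := If (f^-1 g); rewrite !permKV eq_sym.
  apply/existsP; exists a^-1; rewrite groupV Aa /=.
  apply/forallP=> g; apply/forallP=> h.
  apply/eqP/(@perm_inj _ f); rewrite permKV.
  by have /forallP/(_ (f^-1 h))/eqP-> := Tf (a^-1 g); rewrite !permKV.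
have trans X Y Z : cayley_weak_equiv X Y -> cayley_weak_equiv Y Z -> cayley_weak_equiv X Z.
  case/existsP=> f /andP[/forallP If /existsP[a /andP[Aa /forallP Tf]]].
  case/existsP=> k /andP[/forallP Ik /existsP[b /andP[Ab /forallP Tk]]].
  apply/existsP; exists (f * k); apply/andP; split.
    apply/forallP=> g; apply/forallP=> h; rewrite !permM.
    have /forallP/(_ (f h))/eqP-> := Ik (f g).
    by have /forallP/(_ h) := If g.
  apply/existsP; exists (a * b); rewrite groupM //=.
  apply/forallP=> g; apply/forallP=> h; rewrite !permM.
  have /forallP/(_ h)/eqP-> := Tf g.
  by have /forallP/(_ (f h))/eqP-> := Tk (a g).
move=> X Y Z _ _ _; split=> // eXY; apply/idP/idP; last exact: trans.
by apply: trans; apply: sym.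
Qed.

End Cayley.

Arguments Inn gT : clear implicits.
Arguments num_weak_classes gT m : clear implicits.
Arguments num_classes gT m : clear implicits.

Local Open Scope ring_scope.

(* The sum over (j_1, ..., j_n) with j_1 + 2 j_2 + ... + n j_n = n, where j_r is
   (j (r - 1)).  Since r j_r <= n forces j_r <= n, letting each j_r range over
   'I_n.+1 loses no tuple. *)
Definition bracket (c : nat -> rat) (n : nat) : rat :=
  \sum_(j : {ffun 'I_n -> 'I_n.+1} | (\sum_(r < n) r.+1 * j r == n)%N)
    (\prod_(r < n) \prod_(t < j r) (c r.+1 - (r.+1 * t)%:R))
      / (\prod_(r < n) (r.+1 ^ j r * (j r)`!)%N%:R).

(* Main.v *)
(* An isomorphism f with f(gu) = alpha(g) f(u) is u |-> alpha(u) f(1), so it maps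
   C(A, Omega) onto the Cayley graph of the image of Omega under alpha followed
   by conjugation by f(1).  Hence weak equivalence classes (resp. equivalence
   classes) are the orbits of Aut(A) (resp. Inn(A)) on connection sets, which
   Burnside's lemma counts through the connection sets fixed by each alpha.
   Moebius inversion over alpha-invariant subgroups removes the condition that
   Omega generates A.  An alpha-invariant symmetric set splits into its
   noninvolutions, i.e. a set of pairs {g, g^-1} stable under alpha, and its
   involutions.  Each bracket counts the stable n-subsets of a permutation: with
   N_r cycles of length r the factor of index r is 'C(N_r, j_r). *)

Require Import Defs.
From mathcomp Require Import all_boot all_order all_algebra all_fingroup.

Set Implicit Arguments.
Unset Strict Implicit.
Unset Printing Implicit Defensive.

(** * Counting subsets of given total weight *)

Section WeightedSubsets.

Variables (U : finType) (P : {set U}) (w : U -> nat) (n : nat).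
Hypothesis w_gt0 : {in P, forall x, 0 < w x}.

(** The index is shifted by one so that the weights 1, ..., n correspond to ['I_n], as in
    [bracket]. *)
Let level r := [set x in P | w x == r.+1].

(** Double counting: each x in Q lies in exactly one level, of index [(w x).-1], which is below n
    because 0 < w x <= n. *)
Lemma weight_levels (Q : {set U}) :
    Q \subset P -> {in Q, forall x, w x <= n} ->
  \sum_(x in Q) w x = \sum_(r < n) r.+1 * #|Q :&: level r|.
Proof.
move=> sQP le_w.
transitivity (\sum_(x in Q) \sum_(r < n) (w x == r.+1) * r.+1).
  apply: eq_bigr => x Qx; have wx := le_w x Qx.
  have w0 := w_gt0 (subsetP sQP x Qx).
  have ltw : (w x).-1 < n by rewrite prednK.
  rewrite (bigD1 (Ordinal ltw)) //= prednK // eqxx mul1n big1 ?addn0 // => r nr.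
  case: eqP => [Ewr|//]; case/eqP: nr; apply: val_inj.
  by rewrite /= Ewr.
rewrite exchange_big; apply: eq_bigr => r _.
rewrite -big_distrl mulnC; congr (_ * _); rewrite -sum1_card.
rewrite [LHS]big_mkcond [RHS]big_mkcond; apply: eq_bigr => x _.
by rewrite !inE; case Qx: (x \in Q); rewrite //= (subsetP sQP _ Qx); case: eqP.
Qed.

Lemma level_eq r1 r2 x : x \in level r1 -> x \in level r2 -> r1 = r2.
Proof. by rewrite !inE => /andP[_ /eqP->] /andP[_ /eqP[]]. Qed.

Lemma bigcup_level (f : {ffun 'I_n -> {set U}}) (r : 'I_n) :
  (forall s : 'I_n, f s \subset level s) -> (\bigcup_s f s) :&: level r = f r.
Proof.
move=> sf; apply/setP=> x; rewrite inE; apply/andP/idP=> [[/bigcupP[s _ fsx] Lx]|fx].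
  suff <-: s = r by [].
  exact/val_inj/(level_eq (subsetP (sf s) _ fsx) Lx).
by split; [apply/bigcupP; exists r | apply: (subsetP (sf r))].
Qed.

(** A subset is sorted by the numbers j_r of its elements in each level. These numbers determine its
    weight, and for given j the pieces are chosen independently, level by level. *)
Lemma card_weighted_subsets :
  #|[set Q : {set U} | (Q \subset P) && (\sum_(x in Q) w x == n)]| =
  \sum_(j : {ffun 'I_n -> 'I_n.+1} | \sum_(r < n) r.+1 * j r == n)
     \prod_(r < n) 'C(#|level r|, j r).
Proof.
(* [inord] loses nothing when Q has weight n: the piece in level r contributes r + 1 times its size
   to n, so its size is at most n ([hE]). *)
pose h (Q : {set U}) := [ffun r : 'I_n => inord #|Q :&: level r| : 'I_n.+1].
have le_w (Q : {set U}) : \sum_(x in Q) w x == n -> {in Q, forall x, w x <= n}.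
  by move/eqP=> <- x Qx; rewrite (bigD1 x) //= leq_addr.
have hE (Q : {set U}) : Q \subset P -> \sum_(x in Q) w x == n ->
    forall r : 'I_n, h Q r = #|Q :&: level r| :> nat.
  move=> sQ wQ r; rewrite ffunE inordK // ltnS.
  have := wQ; rewrite (weight_levels sQ (le_w Q wQ)) => /eqP {2}<-.
  rewrite (bigD1 r) //=; apply: leq_trans (leq_addr _ _).
  by rewrite mulSn leq_addr.
rewrite -sum1_card (partition_big h (fun j => \sum_(r < n) r.+1 * j r == n)).
  apply: eq_bigr => j /eqP Ej.
  transitivity #|(family (fun r : 'I_n =>
      mem [set A : {set U} | A \subset level r & #|A| == j r])
        : {pred {ffun 'I_n -> {set U}}})|; last first.
    rewrite card_family foldrE big_image /=.
    by apply: eq_bigr => r _; rewrite cards_draws.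
  have fam_sub (f : {ffun 'I_n -> {set U}}) : f \in family (fun r : 'I_n =>
      mem [set A : {set U} | A \subset level r & #|A| == j r]) ->
      forall r, f r \subset level r.
    by move/familyP=> ff r; have := ff r; rewrite inE => /andP[].
  (* Families of pieces correspond to subsets by taking unions; cutting a union by levels recovers
     the pieces because the levels are disjoint. *)
  rewrite -(card_in_imset (f := fun f : {ffun 'I_n -> {set U}} => \bigcup_s f s)).
    rewrite -sum1_card; apply: eq_bigl => Q; rewrite inE.
    apply/andP/imsetP=> [[/andP[sQ wQ] /eqP Ehj]|[f fam ->]].
      exists [ffun r : 'I_n => Q :&: level r].
        apply/familyP=> r; rewrite ffunE inE subsetIr /=.
        by rewrite -(hE Q) // Ehj.
      apply/setP=> x; apply/idP/bigcupP=> [Qx|[r _]]; last first.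
        by rewrite ffunE inE => /andP[].
      have wx := le_w Q wQ x Qx; have Px := subsetP sQ x Qx.
      have ltw : (w x).-1 < n by rewrite prednK ?w_gt0.
      exists (Ordinal ltw) => //; rewrite ffunE !inE Qx Px /=.
      by rewrite prednK ?w_gt0.
    have sf := fam_sub f fam.
    have sP : \bigcup_s f s \subset P.
      apply/bigcupsP=> r _; apply: subset_trans (sf r) _.
      by apply/subsetP=> x; rewrite inE => /andP[].
    have cf (r : 'I_n) : #|(\bigcup_s f s) :&: level r| = j r.
      rewrite bigcup_level //.
      by have /familyP/(_ r) := fam; rewrite inE => /andP[_ /eqP].
    have wf : \sum_(x in \bigcup_s f s) w x = n.
      rewrite weight_levels // => [|x /bigcupP[r _ fx]].
        by rewrite -[RHS]Ej; apply: eq_bigr => r _; rewrite cf.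
      by have := subsetP (sf r) x fx; rewrite inE => /andP[_ /eqP->].
    rewrite sP wf eqxx; split=> //; apply/eqP/ffunP=> r; apply: val_inj.
    by rewrite /= hE ?wf // cf.
  move=> f g /fam_sub sf /fam_sub sg eqfg; apply/ffunP=> r.
  by rewrite -(bigcup_level r sf) eqfg bigcup_level.
move=> Q; rewrite inE => /andP[sQ wQ].
rewrite -[eqbRHS](eqP wQ) weight_levels //; last exact: le_w.
by apply/eqP/eq_bigr => r _; rewrite hE.
Qed.

End WeightedSubsets.

(** * Brackets as numbers of weighted subsets *)

Section Bracket.

Local Open Scope ring_scope.
Import GRing.Theory.

(** Each factor is r (N - t), so the powers of r cancel and the falling factorial of N divided by j!
    remains. *)
Lemma prod_multiples_bin (r N j : nat) : (0 < r)%N ->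
  \prod_(t < j) ((r * N)%:R - (r * t)%:R) / (r ^ j * j`!)%N%:R = 'C(N, j)%:R :> rat.
Proof.
move=> r0.
suff -> : \prod_(t < j) ((r * N)%:R - (r * t)%:R) = (r ^ j * N ^_ j)%:R :> rat.
  rewrite -bin_ffact mulnCA natrM mulfK //.
  by rewrite Num.Theory.pnatr_eq0 -lt0n muln_gt0 expn_gt0 r0 fact_gt0.
elim: j => [|j IHj]; first by rewrite big_ord0.
(* For j <= N the natural subtraction N - j is exact; for j > N both falling factorials vanish. *)
rewrite big_ord_recr /= IHj; have [leNj|ltjN] := leqP j N.
  by rewrite -natrB ?leq_mul2l ?leNj ?orbT // -mulnBr -natrM mulnACA -expnSr ffactnSr.
by rewrite !ffact_small ?muln0 ?mul0r // ltnW.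
Qed.

Lemma eq_bracket (c d : nat -> rat) n :
  (forall r, (0 < r <= n)%N -> c r = d r) -> bracket c n = bracket d n.
Proof.
move=> cd; apply: eq_bigr => j _; congr (_ / _); apply: eq_bigr => r _.
by apply: eq_bigr => t _; rewrite cd //= ltn_ord.
Qed.

Lemma bracket_weighted_subsets (U : finType) (P : {set U}) (w : U -> nat) n :
    {in P, forall x, 0 < w x}%N ->
  bracket (fun r => (r * #|[set x in P | w x == r]|)%:R) n =
  #|[set Q : {set U} | (Q \subset P) && (\sum_(x in Q) w x == n)%N]|%:R.
Proof.
move=> w0; rewrite card_weighted_subsets // natr_sum; apply: eq_bigr => j _.
rewrite natr_prod -prodf_div; apply: eq_bigr => r _.
by rewrite prod_multiples_bin.
Qed.

End Bracket.

(** * Stable subsets of a permutation and its cycles *)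

Section InvariantSubsets.

Import GroupScope.
Variables (T : finType) (p : {perm T}).
Implicit Types (x : T) (X Y : {set T}).

Lemma imset_perm_stable Y : {in Y, forall x, p x \in Y} -> p @: Y = Y.
Proof.
move=> pY; apply/eqP; rewrite eqEcard (card_imset _ perm_inj) leqnn andbT.
by apply/subsetP=> _ /imsetP[x Yx ->]; apply: pY.
Qed.

Lemma porbit_stable Y x : p @: Y = Y -> x \in Y -> porbit p x \subset Y.
Proof.
move=> pY Yx; apply/subsetP=> _ /porbitP[i ->]; rewrite permX.
by elim: i => //= i IHi; rewrite -pY imset_f.
Qed.

(** For r > 0 this makes r the least positive exponent fixing x; for r = 0 it holds for every x. *)
Definition exact_period r x :=
  ((p ^+ r) x == x) && [forall l : 'I_r, (0 < l) ==> ((p ^+ l) x != x)].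

(** With q the cycle length, the first q iterates of x are distinct and the q-th returns to x, so q
    is the least positive exponent fixing x. *)
Lemma card_porbitE r x : 0 < r -> (#|porbit p x| == r) = exact_period r x.
Proof.
move=> r0; rewrite /exact_period; set q := #|_|.
have q0 : 0 < q by rewrite lt0n card_porbit_neq0.
have pq : (p ^+ q) x = x by rewrite permX iter_porbit.
have min l : 0 < l < q -> (p ^+ l) x != x.
  case/andP=> l0 lq; have := nth_uniq x _ _ (uniq_traject_porbit p x).
  move=> /(_ l 0); rewrite size_traject => /(_ lq q0).
  by rewrite !nth_traject // permX /= => ->; rewrite -lt0n.
apply/eqP/andP=> [<-|[pr /forallP minr]].
  by split; [apply/eqP | apply/forallP=> l; apply/implyP=> l0; rewrite min ?l0 /=].
case: (ltngtP q r) => // [ltqr|ltrq].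
  by have /implyP/(_ q0) := minr (Ordinal ltqr); rewrite pq eqxx.
by have := min r; rewrite r0 ltrq pr => /(_ isT).
Qed.

Lemma porbit_partition Y : p @: Y = Y -> partition (porbit p @: Y) Y.
Proof.
move=> pY; apply/and3P; split.
- apply/eqP/setP=> x; apply/bigcupP/idP=> [[_ /imsetP[y Yy ->]]|Yx].
    exact/subsetP/porbit_stable.
  by exists (porbit p x); rewrite ?imset_f ?porbit_id.
- apply/trivIsetP=> _ _ /imsetP[x _ ->] /imsetP[y _ ->].
  apply: contraNT => /pred0Pn[z /= /andP[xz yz]].
  by move: xz yz; rewrite -!eq_porbit_mem => /eqP<- /eqP<-.
- by apply/imsetP=> [[x _ /setP/(_ x)]]; rewrite porbit_id inE.
Qed.

(** A stable subset is a union of cycles, so choosing one of size n amounts to choosing cycles of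
    total length n: weighted subsets with length as weight. *)
Lemma bracket_invariant_subsets X n : p @: X = X ->
  bracket (fun r => #|[set x in X | exact_period r x]|%:R%R) n =
  (#|[set Y : {set T} | [&& Y \subset X, p @: Y == Y & #|Y| == n]]|%:R)%R.
Proof.
move=> pX; pose P := porbit p @: X.
have P0 : {in P, forall B : {set T}, 0 < #|B|}.
  by move=> _ /imsetP[x _ ->]; rewrite lt0n card_porbit_neq0.
transitivity (bracket (fun r => (r * #|[set B in P | #|B| == r]|)%N%:R%R) n).
  apply: eq_bracket => r /andP[r0 _]; congr _%:R%R.
  (* The points of period r are partitioned into the cycles of length r, so they number r times
     these cycles. *)
  set E := [set x in X | _].
  have memE x : (x \in E) = (x \in X) && (#|porbit p x| == r).
    by rewrite inE card_porbitE.
  have pE : p @: E = E.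
    apply: imset_perm_stable => x; rewrite !memE => /andP[Xx].
    by have:= porbit_perm p 1 x; rewrite expg1 => ->; rewrite -pX imset_f.
  suff -> : [set B in P | #|B| == r] = porbit p @: E.
    rewrite mulnC; apply: card_uniform_partition (porbit_partition pE).
    by move=> _ /imsetP[x + ->]; rewrite memE => /andP[_ /eqP].
  apply/setP=> B; rewrite inE; apply/andP/imsetP.
    by case=> /imsetP[x Xx ->] pr; exists x; rewrite // memE Xx.
  by case=> x; rewrite memE => /andP[Xx pr] ->; rewrite imset_f.
rewrite bracket_weighted_subsets //; congr _%:R%R.
(* Y is encoded by the set of its cycles and decoded by [cover]; its size is the sum of their
   lengths. *)
rewrite -[RHS](card_in_imset (f := fun Y : {set T} => porbit p @: Y)).
  apply: eq_card => Q; rewrite inE; apply/andP/imsetP=> [[sQP sumQ]|[Y]].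
    have EQ : porbit p @: cover Q = Q.
      apply/setP=> B; apply/imsetP/idP=> [[x /bigcupP[C QC Cx] ->]|QB].
        have /imsetP[y _ Ey] := subsetP sQP C QC.
        suff -> : porbit p x = C by [].
        by apply/eqP; rewrite Ey eq_porbit_mem -Ey.
      have /imsetP[x _ Ex] := subsetP sQP B QB; exists x => //.
      by apply/bigcupP; exists B; rewrite // Ex porbit_id.
    have pQ : p @: cover Q = cover Q.
      apply: imset_perm_stable => x /bigcupP[C QC Cx]; apply/bigcupP; exists C => //.
      have /imsetP[y _ Ey] := subsetP sQP C QC.
      move: Cx; rewrite Ey -!eq_porbit_mem => /eqP<-.
      by have:= porbit_perm p 1 x; rewrite expg1 => ->.
    exists (cover Q) => //; rewrite inE pQ eqxx.
    rewrite (card_partition (porbit_partition pQ)) EQ sumQ /= andbT.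
    apply/bigcupsP=> B QB; have /imsetP[x Xx ->] := subsetP sQP B QB.
    exact: porbit_stable.
  rewrite inE => /and3P[sYX /eqP pY /eqP cY] ->; split; first exact: imsetS.
  by rewrite -(card_partition (porbit_partition pY)) cY.
have coverY Y : Y \in [set Y : {set T} | [&& Y \subset X, p @: Y == Y & #|Y| == n]] ->
    cover (porbit p @: Y) = Y.
  by rewrite inE => /and3P[_ /eqP/porbit_partition/cover_partition].
by move=> Y Z /coverY {2}<- /coverY {2}<- ->.
Qed.

End InvariantSubsets.

(** * Inverse pairs and the action of an automorphism on them *)

Section InversePairs.

Import GroupScope.
Variable gT : finGroupType.
Implicit Types (g h : gT) (Y : {set gT}).

Definition inv_pair g : {set gT} := [set g; g^-1].

Lemma inv_pairV g : inv_pair g^-1 = inv_pair g.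
Proof. by rewrite /inv_pair invgK setUC. Qed.

Lemma inv_pair_eq g h : (inv_pair g == inv_pair h) = (g \in inv_pair h).
Proof.
apply/eqP/idP=> [<-|]; first by rewrite set21.
by case/set2P=> ->; rewrite ?inv_pairV.
Qed.

Lemma inv_pair_partition Y : Y^-1 = Y -> partition (inv_pair @: Y) Y.
Proof.
move=> symY; apply/and3P; split.
- apply/eqP/setP=> x; apply/bigcupP/idP=> [[_ /imsetP[y Yy ->]]|Yx].
    by case/set2P=> -> //; rewrite -symY mem_invg invgK.
  by exists (inv_pair x); rewrite ?imset_f ?set21.
- apply/trivIsetP=> _ _ /imsetP[x _ ->] /imsetP[y _ ->].
  apply: contraNT => /pred0Pn[z /= /andP[xz yz]].
  by move: xz yz; rewrite -!inv_pair_eq => /eqP<- /eqP<-.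
- by apply/imsetP=> [[x _ /setP/(_ x)]]; rewrite set21 inE.
Qed.

Lemma card_inv_pairs Y : Y^-1 = Y -> {in Y, forall g, g != g^-1} ->
  #|Y| = (2 * #|inv_pair @: Y|)%N.
Proof.
move=> symY ninvY; rewrite mulnC.
apply: card_uniform_partition (inv_pair_partition symY).
by move=> _ /imsetP[g Yg ->]; rewrite cards2 ninvY.
Qed.

Variable alpha : {perm gT}.
Hypothesis autA : alpha \in Aut [set: gT].

Lemma AutV g : alpha g^-1 = (alpha g)^-1.
Proof. by rewrite -(autmE autA) morphV ?inE. Qed.

Lemma Aut_invset Y : (alpha @: Y)^-1 = alpha @: Y^-1.
Proof.
apply/setP=> g; rewrite mem_invg; apply/imsetP/imsetP=> [[h Yh Eg]|[h Yh ->]].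
  by exists h^-1; rewrite ?mem_invg ?invgK // AutV -Eg invgK.
by exists h^-1; rewrite -?mem_invg // AutV.
Qed.

(** Turns [alpha] into a permutation of subsets, so that the results on cycles apply with inverse
    pairs as points. *)
Definition set_perm : {perm {set gT}} := perm (imset_inj (@perm_inj _ alpha)).

Lemma set_perm_pairX l g : (set_perm ^+ l) (inv_pair g) = inv_pair ((alpha ^+ l) g).
Proof.
rewrite !permX; elim: l => //= l ->; rewrite permE.
by rewrite /inv_pair imsetU1 imset_set1 AutV.
Qed.

Lemma set_perm_pairs Y : set_perm @: (inv_pair @: Y) = inv_pair @: (alpha @: Y).
Proof.
rewrite -!imset_comp; apply: eq_imset => g /=.
by have := set_perm_pairX 1 g; rewrite !expg1.
Qed.

(** The identity lies in neither of the next two sets: it equals its inverse, and [involutions]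
    excludes it explicitly. *)
Definition noninvolutions (S : {group gT}) := [set g in S | g != g^-1].
Definition involutions (S : {group gT}) := [set g in S | (g^-1 == g) && (g != 1)].

Variable S : {group gT}.
Hypothesis invS : aut_invariant alpha S.

Lemma aut_invariant_mem g : g \in S -> alpha g \in S.
Proof. by move=> Sg; rewrite -(eqP invS) imset_f. Qed.

Lemma noninvolutions_stable : alpha @: noninvolutions S = noninvolutions S.
Proof.
apply: imset_perm_stable => g; rewrite !inE -AutV (inj_eq perm_inj).
by case/andP=> /aut_invariant_mem ->.
Qed.

Lemma involutions_stable : alpha @: involutions S = involutions S.
Proof.
apply: imset_perm_stable => g; rewrite !inE -AutV (inj_eq perm_inj).
have alpha1 : alpha 1 = 1 by rewrite -(autmE autA) morph1.
by rewrite -{2}alpha1 (inj_eq perm_inj) => /andP[/aut_invariant_mem ->].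
Qed.

(** A power of [alpha] fixes the pair {g, g^-1} exactly when it sends g to g or to g^-1, so the two
    sets are the two ways for the pair to have period r. *)
Lemma FtildeUItildeE r : Ftilde alpha r S :|: Itilde alpha r S =
  [set g in noninvolutions S | exact_period set_perm r (inv_pair g)].
Proof.
apply/setP=> g; rewrite !inE /exact_period set_perm_pairX inv_pair_eq !inE.
have -> : [forall l : 'I_r, (0 < l) ==>
    ((set_perm ^+ l) (inv_pair g) != inv_pair g)] =
  [forall l : 'I_r, (0 < l) ==>
    ((alpha ^+ l) g != g) && ((alpha ^+ l) g != g^-1)].
  apply: eq_forallb => l; rewrite set_perm_pairX inv_pair_eq !inE.
  by rewrite negb_or.
by case: (g \in S); case: (g != _); case: [forall l, _]; rewrite ?andbT ?andbF ?orbF.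
Qed.

(** The two sets are disjoint because g and g^-1 differ, and each pair of period r contributes two
    elements. This accounts for the division by 2 in the formula. *)
Lemma card_period_pairs r :
  (#|Ftilde alpha r S| + #|Itilde alpha r S|)%N =
  (2 * #|[set B in inv_pair @: noninvolutions S | exact_period set_perm r B]|)%N.
Proof.
have disjFI : Ftilde alpha r S :&: Itilde alpha r S = set0.
  apply/setP=> g; rewrite !inE; apply/negP=> /andP[/and4P[_ ng /eqP -> _]].
  by case/and4P=> _ _ ng'; rewrite (negPf ng) in ng'.
rewrite -cardsUI disjFI cards0 addn0 FtildeUItildeE card_inv_pairs.
- congr (2 * _)%N; apply: eq_card => B; rewrite [RHS]inE.
  apply/imsetP/andP=> [[g]|[/imsetP[g Sg ->] per]].
    by rewrite inE => /andP[Sg per] ->; rewrite imset_f.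
  by exists g; rewrite // inE Sg.
- by apply/setP=> g; rewrite mem_invg !inE invgK inv_pairV groupV [g^-1 == g]eq_sym.
- by move=> g; rewrite !inE => /andP[/andP[]].
Qed.

Definition sym_invariant_sets k := [set Y : {set gT} |
  [&& Y \subset noninvolutions S, Y^-1 == Y, alpha @: Y == Y & #|Y| == 2 * k]]%N.

(** A symmetric stable set of 2k noninvolutions is the union of a stable set of k inverse pairs, and
    the cycle count applies to the pairs. *)
Lemma bracket_noninvolutions k :
  bracket (fun r => (#|Ftilde alpha r S| + #|Itilde alpha r S|)%N%:R / 2)%R k =
  #|sym_invariant_sets k|%:R%R.
Proof.
pose X := inv_pair @: noninvolutions S.
rewrite (@eq_bracket _
  (fun r => #|[set B in X | exact_period set_perm r B]|%:R%R)); last first.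
  by move=> r _; rewrite card_period_pairs GRing.natrM GRing.mulrC GRing.mulKf.
rewrite bracket_invariant_subsets ?set_perm_pairs ?noninvolutions_stable //.
congr _%:R%R; rewrite -[RHS](card_in_imset (f := fun Y : {set gT} => inv_pair @: Y)).
  apply: eq_card => Q; rewrite inE; apply/and3P/imsetP=> [[sQX /eqP pQ cQ]|[Y]].
    have EQ : inv_pair @: cover Q = Q.
      apply/setP=> B; apply/imsetP/idP=> [[x /bigcupP[C QC Cx] ->]|QB].
        have /imsetP[y _ Ey] := subsetP sQX C QC.
        suff -> : inv_pair x = C by [].
        by apply/eqP; rewrite Ey inv_pair_eq -Ey.
      have /imsetP[x _ Ex] := subsetP sQX B QB; exists x => //.
      by apply/bigcupP; exists B; rewrite // Ex set21.
    have symQ : (cover Q)^-1 = cover Q.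
      apply/setP=> x; rewrite mem_invg; apply/bigcupP/bigcupP=> [] [B QB Bx];
      exists B => //; have /imsetP[y _ Ey] := subsetP sQX B QB;
      by move: Bx; rewrite Ey -!inv_pair_eq inv_pairV.
    have sQ : cover Q \subset noninvolutions S.
      apply/bigcupsP=> B QB; have /imsetP[x + ->] := subsetP sQX B QB.
      rewrite inE => /andP[Sx nx]; apply/subsetP=> y.
      by case/set2P=> ->; rewrite inE ?groupV Sx ?invgK // eq_sym.
    exists (cover Q) => //; rewrite inE sQ symQ eqxx /=; apply/andP; split.
      (* [alpha @: cover Q] is symmetric, hence the union of its inverse pairs; these are the images
         of the pairs in Q, which form Q again. *)
      apply/eqP; rewrite -(cover_partition (inv_pair_partition symQ)).
      have symaQ : (alpha @: cover Q)^-1 = alpha @: cover Q by rewrite Aut_invset symQ.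
      rewrite (cover_partition (inv_pair_partition symQ)).
      rewrite -(cover_partition (inv_pair_partition symaQ)).
      by rewrite -set_perm_pairs EQ pQ.
    rewrite card_inv_pairs // ?EQ ?(eqP cQ) // => g /(subsetP sQ).
    by rewrite inE => /andP[].
  rewrite inE => /and4P[sY /eqP symY /eqP aY cY] ->.
  split; [exact: imsetS | by rewrite set_perm_pairs aY |].
  rewrite card_inv_pairs // ?eqn_pmul2l // in cY => g /(subsetP sY).
  by rewrite inE => /andP[].
have coverY Y : Y \in sym_invariant_sets k -> cover (inv_pair @: Y) = Y.
  by rewrite inE => /and4P[_ /eqP/inv_pair_partition/cover_partition].
by move=> Y Z /coverY {2}<- /coverY {2}<- ->.
Qed.

Lemma bracket_involutions n :
  bracket (fun l => #|Fotilde alpha l S|%:R%R) n =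
  (#|[set Y : {set gT} |
      [&& Y \subset involutions S, alpha @: Y == Y & #|Y| == n]]|%:R)%R.
Proof.
rewrite -bracket_invariant_subsets ?involutions_stable //.
apply: eq_bracket => r _; congr _%:R%R; apply: eq_card => g.
by rewrite !inE -!andbA.
Qed.

End InversePairs.

Arguments inv_pair {gT} g.

(** * Connection sets fixed by an automorphism *)

Section FixedConnectionSets.

Import GroupScope.
Variables (gT : finGroupType) (alpha : {perm gT}) (m : nat).
Hypothesis autA : alpha \in Aut [set: gT].
Implicit Types (S : {group gT}) (Y Omega : {set gT}).

(** Generation of the whole group is relaxed here to inclusion in S; Moebius inversion restores
    it. *)
Definition sym_sets_in S := [set Omega : {set gT} | (Omega \subset S) &&
  [&& 1 \notin Omega, Omega^-1 == Omega, alpha @: Omega == Omega & #|Omega| == m]].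

(** Omega is the disjoint union of its noninvolutions, which form k inverse pairs, and its
    involutions; the two parts vary independently. *)
Lemma card_sym_sets_in S : aut_invariant alpha S ->
  #|sym_sets_in S| = (\sum_(k < (m %/ 2).+1) #|sym_invariant_sets alpha S k| *
    #|[set Y : {set gT} |
      [&& Y \subset involutions S, alpha @: Y == Y & #|Y| == m - 2 * k]]|)%N.
Proof.
move=> invS; pose N := noninvolutions S; pose I := involutions S.
have disjNI : N :&: I = set0.
  apply/setP=> g; rewrite !inE [g^-1 == g]eq_sym.
  by case: (g == _); rewrite ?andbF.
have NUI Omega : Omega \subset S -> 1 \notin Omega ->
    Omega = (Omega :&: N) :|: (Omega :&: I).
  move=> sOS nO; apply/setP=> g; rewrite !inE [g^-1 == g]eq_sym.
  case Og: (g \in Omega) => //=; rewrite (subsetP sOS) //=.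
  by case: (g == g^-1) => //=; case: eqP => // Eg; rewrite -Eg Og in nO.
have symN : N^-1 = N.
  by apply/setP=> g; rewrite mem_invg !inE groupV invgK [g^-1 == g]eq_sym.
have symI Y : Y \subset I -> Y^-1 = Y.
  move=> sYI; have YV g : g \in Y -> g^-1 = g.
    by move/(subsetP sYI); rewrite inE => /and3P[_ /eqP].
  apply/setP=> g; rewrite mem_invg; apply/idP/idP=> Yg.
    by rewrite -[g]invgK YV.
  by rewrite YV.
have invsetI (A B : {set gT}) : (A :&: B)^-1 = A^-1 :&: B^-1.
  by apply/setP=> g; rewrite !(mem_invg, inE).
have invsetU (A B : {set gT}) : (A :|: B)^-1 = A^-1 :|: B^-1.
  by apply/setP=> g; rewrite !(mem_invg, inE).
have alphaI (A B : {set gT}) : alpha @: A = A -> alpha @: B = B ->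
    alpha @: (A :&: B) = A :&: B.
  by move=> aA aB; rewrite imsetI ?aA ?aB // => x y _ _; apply: perm_inj.
have cardN Omega : Omega^-1 = Omega ->
    #|Omega :&: N| = (2 * #|inv_pair @: (Omega :&: N)|)%N.
  move=> symO; apply: card_inv_pairs; first by rewrite invsetI symO symN.
  by move=> g; rewrite !inE => /and3P[].
(* For symmetric Omega the halving is exact, and m elements contain at most [m %/ 2] pairs. *)
pose h Omega : 'I_(m %/ 2).+1 := inord (#|Omega :&: N| %/ 2).
have hE Omega : Omega \in sym_sets_in S -> #|Omega :&: N| = (2 * h Omega)%N.
  rewrite inE => /and5P[_ _ /eqP symO _ /eqP cO].
  rewrite {1}cardN // inordK; first by rewrite [in RHS]cardN // mulKn.
  by rewrite ltnS leq_div2r // -cO subset_leq_card ?subsetIl.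
rewrite -sum1_card (partition_big h predT) //=; apply: eq_bigr => k _.
rewrite -cardsX sum1dep_card.
set A := sym_invariant_sets _ _ _; set B := [set Y : {set gT} | _].
have memAB u : u \in setX A B -> [/\ u.1 \in A, u.2 \in B,
    (u.1 :|: u.2) :&: N = u.1 & (u.1 :|: u.2) :&: I = u.2].
  rewrite inE => /andP[Au Bu]; split=> //.
    have [sA sB] : u.1 \subset N /\ u.2 \subset I.
      by move: Au Bu; rewrite !inE => /andP[-> _] /andP[-> _].
    rewrite setIUl (setIidPl sA).
    suff -> : u.2 :&: N = set0 by rewrite setU0.
    by apply/eqP; rewrite -subset0 -disjNI setIC setIS.
  have [sA sB] : u.1 \subset N /\ u.2 \subset I.
    by move: Au Bu; rewrite !inE => /andP[-> _] /andP[-> _].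
  rewrite setIUl (setIidPl sB).
  suff -> : u.1 :&: I = set0 by rewrite set0U.
  by apply/eqP; rewrite -subset0 -disjNI setSI.
(* Taking the union is inverse to intersecting with [N] and [I]. *)
rewrite -[RHS](card_in_imset (f := fun u : {set gT} * {set gT} => u.1 :|: u.2)).
  apply: eq_card => Omega; rewrite inE; apply/andP/imsetP=> [[mO /eqP hO]|].
    have := hE _ mO; rewrite hO => cN.
    move: mO; rewrite inE => /and5P[sO nO /eqP symO /eqP aO /eqP cO].
    have EO := NUI _ sO nO.
    exists (Omega :&: N, Omega :&: I) => //=; rewrite !inE /= !subsetIr /=.
    rewrite invsetI symO symN !alphaI ?noninvolutions_stable ?involutions_stable //.
    have Em : m = (2 * k + #|Omega :&: I|)%N.
      by rewrite -{1}cO {1}EO cardsU setIACA disjNI setI0 cards0 subn0 cN.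
    (* The type of [k] depends on m, so its value is generalized before m is replaced. *)
    rewrite cN !eqxx /=; apply/eqP; move: (nat_of_ord k) Em => i ->.
    by rewrite addKn.
  case=> u /memAB[Au Bu EN EI] EO.
  have cN : #|Omega :&: N| = (2 * k)%N.
    by rewrite EO EN; move: Au; rewrite inE => /and4P[_ _ _ /eqP].
  suff mO : Omega \in sym_sets_in S.
    split=> //; apply/eqP/val_inj/eqP.
    by rewrite -(eqn_pmul2l (isT : 0 < 2)) -hE // cN.
  move: Au Bu; rewrite !inE => /and4P[sA /eqP sym1 /eqP a1 /eqP c1].
  case/and3P=> sB /eqP a2 /eqP c2; rewrite EO.
  rewrite invsetU sym1 symI // imsetU a1 a2 !eqxx.
  have disj12 : u.1 :&: u.2 = set0 by rewrite -EN -EI setIACA disjNI setI0.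
  rewrite cardsU disj12 cards0 subn0 c1 c2.
  (* The bound k <= [m %/ 2] makes the truncated subtraction m - 2k exact. *)
  rewrite subnKC; last first.
    by rewrite mulnC -leq_divRL // -ltnS.
  rewrite eqxx !andbT in_setU negb_or; apply/and3P; split.
  - rewrite subUset; apply/andP; split.
      by apply: subset_trans sA _; apply/subsetP=> g; rewrite inE => /andP[].
    by apply: subset_trans sB _; apply/subsetP=> g; rewrite inE => /andP[].
  - by apply/negP=> /(subsetP sA); rewrite inE invg1 eqxx andbF.
  - by apply/negP=> /(subsetP sB); rewrite inE eqxx !andbF.
move=> [u1 u2] [v1 v2] /memAB[_ _ /= Eu1 Eu2] /memAB[_ _ /= Ev1 Ev2] E.
by congr (_, _); [rewrite -Eu1 E | rewrite -Eu2 E].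
Qed.

Lemma Aut_gen Y : <<alpha @: Y>> = alpha @: <<Y>>.
Proof.
have E (Z : {set gT}) : alpha @: Z = autm autA @* Z by rewrite morphimEsub ?subsetT ?autmE.
by rewrite !E morphim_gen ?subsetT.
Qed.

(* Moebius inversion: the subgroups S with <<Omega>> <= S contribute
   [<<Omega>> = A] in total. *)
Lemma sum_moebius_sym_sets :
  (\sum_(S : {group gT} | aut_invariant alpha S)
     (moebius alpha S)%:~R * #|sym_sets_in S|%:R =
  #|[set Omega in cayley_sets gT m | alpha @: Omega == Omega]|%:R :> rat)%R.
Proof.
pose base := [set Omega : {set gT} |
  [&& 1 \notin Omega, Omega^-1 == Omega, alpha @: Omega == Omega & #|Omega| == m]].
transitivity (\sum_(S : {group gT} | aut_invariant alpha S)
   \sum_(Omega in base) (moebius alpha S)%:~R * (Omega \subset S)%:R : rat)%R.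
  apply: eq_bigr => S _; rewrite -GRing.mulr_sumr -GRing.natr_sum; congr (_ * _%:R)%R.
  rewrite -big_mkcondr -sum1_card /=; apply: eq_bigl => Omega.
  by rewrite !inE andbC.
rewrite exchange_big /=.
transitivity (\sum_(Omega in base) (<<Omega>> == [set: gT])%:R : rat)%R.
  apply: eq_bigr => Omega; rewrite inE => /and4P[_ _ /eqP aO _].
  (* A stable Omega generates an invariant subgroup, so the defining relation of the Moebius
     function is available at [<<Omega>>]. *)
  have invO : aut_invariant alpha <<Omega>>.
    by rewrite /aut_invariant /= -Aut_gen aO.
  have := moebiusP invO; move/(congr1 (fun z : int => z%:~R : rat)%R).
  rewrite GRing.rmorph_sum /= => E; transitivity ((<<Omega>> == [set: gT])%:R%:~R : rat)%R.
    rewrite -[RHS]E [LHS]big_mkcond [RHS]big_mkcond; apply: eq_bigr => S _.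
    rewrite gen_subG andbC; case: aut_invariant; case: (_ \subset _) => //=.
      by rewrite GRing.mulr1.
    by rewrite GRing.mulr0.
  by case: eqP.
rewrite -GRing.natr_sum; congr _%:R%R.
rewrite -big_mkcondr -sum1_card /=; apply: eq_bigl => Omega.
rewrite !inE /cayley_set -!andbA.
by do !case: (_ == _); rewrite ?andbT ?andbF.
Qed.

Lemma card_fixed_connection_sets :
  (#|[set Omega in cayley_sets gT m | alpha @: Omega == Omega]|%:R =
  \sum_(k < (m %/ 2).+1) \sum_(S : {group gT} | aut_invariant alpha S)
    (moebius alpha S)%:~R
    * bracket (fun r => (#|Ftilde alpha r S| + #|Itilde alpha r S|)%N%:R / 2) k
    * bracket (fun l => #|Fotilde alpha l S|%:R) (m - 2 * k))%R.
Proof.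
rewrite -sum_moebius_sym_sets exchange_big /=; apply: eq_bigr => S invS.
rewrite card_sym_sets_in // GRing.natr_sum GRing.mulr_sumr; apply: eq_bigr => k _.
by rewrite bracket_noninvolutions // bracket_involutions // GRing.natrM GRing.mulrA.
Qed.

Lemma Aut_cayley_sets Omega :
  Omega \in cayley_sets gT m -> alpha @: Omega \in cayley_sets gT m.
Proof.
rewrite !inE /cayley_set => /andP[/and3P[/eqP gO /eqP symO nO] cO].
rewrite Aut_gen gO Aut_invset // symO eqxx (card_imset _ perm_inj) cO !andbT.
have alpha1 : alpha 1 = 1 by rewrite -(autmE autA) morph1.
rewrite -alpha1 (mem_imset _ _ perm_inj) nO andbT.
by rewrite eqEcard subsetT (card_imset _ perm_inj) leqnn.
Qed.

End FixedConnectionSets.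

(** * Equivalence classes as orbits *)

Section Classes.

Import GroupScope.
Variable gT : finGroupType.
Implicit Types (alpha f : {perm gT}) (Omega : {set gT}).

(** Burnside's lemma: the hypothesis on [e] makes its classes the orbits of H on connection sets. A
    general H serves both Aut and Inn. *)
Lemma card_orbit_classes (H : {group {perm gT}}) (e : rel {set gT}) m :
    H \subset Aut [set: gT] ->
    (forall Omega Omega',
       e Omega Omega' <-> exists2 alpha, alpha \in H & alpha @: Omega = Omega') ->
  (#|H| * #|equivalence_partition e (cayley_sets gT m)| =
   \sum_(alpha in H) #|[set Omega in cayley_sets gT m | alpha @: Omega == Omega]|)%N.
Proof.
move=> sHA eP; have actH : [acts H, on cayley_sets gT m | 'P^*].
  apply/actsP=> a Ha X; have aA := subsetP sHA a Ha; rewrite /= setactE.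
  apply/idP/idP=> [|XC]; last exact: Aut_cayley_sets.
  (* If the image of X under a is a connection set, applying a^-1 shows that X is one. *)
  have := @Aut_cayley_sets _ a^-1 m (groupVr aA) (a @: X).
  move=> + XC => /(_ XC); rewrite -imset_comp (eq_imset (g := id)) ?imset_id //.
  by move=> x /=; rewrite permK.
have := Frobenius_Cauchy actH; rewrite mulnC => E.
have -> : equivalence_partition e (cayley_sets gT m) = orbit 'P^* H @: cayley_sets gT m.
  rewrite /equivalence_partition; apply: eq_in_imset => X XC; apply/setP=> Y; rewrite inE.
  apply/andP/orbitP=> [[_ /eP[a Ha <-]]|[a Ha <-]]; first by exists a.
  by split; [rewrite (actsP actH) | apply/eP; exists a].
rewrite -E; apply: eq_bigr => a Ha; apply: eq_card => X.
by rewrite !inE sub1set inE /= setactE.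
Qed.

(** Since f(x) = alpha(x) f(1), the vertex x is adjacent to 1 exactly when f(1)^-1 alpha(x) f(1)
    lies in Omega'. Products of permutations act left to right, so [alpha] comes first. *)
Lemma twisted_iso_imset alpha f Omega Omega' :
    graph_iso (cayley_adj Omega) (cayley_adj Omega') f -> twisted_by alpha f ->
  (alpha * conj_aut [set: gT] (f 1)) @: Omega = Omega'.
Proof.
move=> /forallP isof /forallP twf.
have memE x : ((alpha * conj_aut [set: gT] (f 1)) x \in Omega') = (x \in Omega).
  have /forallP/(_ x)/eqP := isof 1; rewrite /cayley_adj /= invg1 mul1g => <-.
  have /forallP/(_ 1)/eqP := twf x; rewrite mulg1 => ->.
  by rewrite permM conj_autE ?inE // conjgE.
apply/setP=> y; rewrite -[y](permKV (alpha * conj_aut [set: gT] (f 1))).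
by rewrite memE (mem_imset _ _ perm_inj).
Qed.

(** One direction absorbs f(1) into an inner automorphism; in the other, [alpha] serves both as the
    isomorphism and as its own twist. *)
Lemma cayley_weak_equivP Omega Omega' : cayley_weak_equiv Omega Omega' <->
  exists2 alpha, alpha \in Aut [set: gT] & alpha @: Omega = Omega'.
Proof.
split=> [/existsP[f /andP[isof /existsP[a /andP[Aa twf]]]]|[a Aa <-]].
  exists (a * conj_aut [set: gT] (f 1)); last exact: twisted_iso_imset.
  by rewrite groupM // (subsetP (Aut_conj_aut _ [set: gT])) // mem_morphim ?inE //= normG.
have aM g h : a (g * h) = a g * a h by rewrite -(autmE Aa) morphM ?inE.
apply/existsP; exists a; apply/andP; split.
  apply/forallP=> g; apply/forallP=> h; rewrite /cayley_adj /=.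
  by rewrite -AutV // -aM (mem_imset _ _ perm_inj).
apply/existsP; exists a; rewrite Aa; apply/forallP=> g; apply/forallP=> h.
by rewrite aM.
Qed.

Lemma cayley_equivP Omega Omega' : cayley_equiv Omega Omega' <->
  exists2 alpha, alpha \in Inn gT & alpha @: Omega = Omega'.
Proof.
split=> [/existsP[f /andP[isof twf]]|[_ /morphimP[c _ _ ->] <-]].
  exists (1 * conj_aut [set: gT] (f 1)); last exact: twisted_iso_imset.
  by rewrite mul1g mem_morphim ?(subsetP (normG _)) ?inE.
(* Conjugation by c is realised by the right translation u |-> u c, which commutes with left
   multiplication. *)
apply/existsP; exists (perm (@mulIg _ c)); apply/andP; split; last first.
  by apply/forallP=> g; apply/forallP=> h; rewrite !permE mulgA.
apply/forallP=> g; apply/forallP=> h; rewrite /cayley_adj /= !permE.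
have -> : (g * c)^-1 * (h * c) = conj_aut [set: gT] c (g^-1 * h).
  by rewrite conj_autE ?inE // conjgE invMg !mulgA.
by rewrite (mem_imset _ _ perm_inj).
Qed.

End Classes.

(** * The two counting identities *)

Local Open Scope ring_scope.

Theorem theorem3p3 (gT : finGroupType) (m : nat) (hm : (0 < m)%N) :
  (#|Aut [set: gT]| * num_weak_classes gT m)%N%:R =
    \sum_(k < (m %/ 2).+1)
      \sum_(alpha in Aut [set: gT])
        \sum_(S : {group gT} | aut_invariant alpha S)
          (moebius alpha S)%:~R
          * bracket (fun r => (#|Ftilde alpha r S| + #|Itilde alpha r S|)%N%:R / 2) k
          * bracket (fun l => #|Fotilde alpha l S|%:R) (m - 2 * k)
  /\
  (#|Inn gT| * num_classes gT m)%N%:R =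
    \sum_(k < (m %/ 2).+1)
      \sum_(alpha in Inn gT)
        \sum_(S : {group gT} | aut_invariant alpha S)
          (moebius alpha S)%:~R
          * bracket (fun r => (#|Ftilde alpha r S| + #|Itilde alpha r S|)%N%:R / 2) k
          * bracket (fun l => #|Fotilde alpha l S|%:R) (m - 2 * k).
Proof.
(* Both identities are instances of one, for a subgroup H of Aut whose orbits are the classes. *)
have count (H : {group {perm gT}}) (e : rel {set gT}) : H \subset Aut [set: gT] ->
    (forall Omega Omega', e Omega Omega' <->
      exists2 alpha : {perm gT}, alpha \in H & alpha @: Omega = Omega') ->
  (#|H| * #|equivalence_partition e (cayley_sets gT m)|)%N%:R =
    \sum_(k < (m %/ 2).+1) \sum_(alpha in H)
      \sum_(S : {group gT} | aut_invariant alpha S)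
        (moebius alpha S)%:~R
        * bracket (fun r => (#|Ftilde alpha r S| + #|Itilde alpha r S|)%N%:R / 2) k
        * bracket (fun l => #|Fotilde alpha l S|%:R) (m - 2 * k).
  move=> sHA eP; rewrite card_orbit_classes // GRing.natr_sum exchange_big /=.
  by apply: eq_bigr => alpha /(subsetP sHA)/card_fixed_connection_sets.
split; first exact: (count [group of Aut _] _ _ (@cayley_weak_equivP gT)).
exact: (count [group of Inn gT] _ (Aut_conj_aut _ _) (@cayley_equivP gT)).
Qed.
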